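(* For every positive integer $n$, during a complete run of $\mathrm{RuleDesc}(n)$, the write statements executed after initialisation are ''$d_k\leftarrow m$'' (inside the last inner loop) and ''$d_k\leftarrow n'$''. Together they are executed a total of exactly $\sum_{x=1}^{n}p(x) - 1$ times.
   Context: $p(n)$ denotes the number of partitions of $n$. The procedure $\mathrm{RuleDesc}(n)$, for $n>0$, operates on an array $d$ as follows and visits every descending composition of $n$ (a sequence of positive integers in nonincreasing order summing to $n$) exactly once, in reverse lexicographic order: 1. Initialisation: $d_1\leftarrow n$; $k\leftarrow 1$; visit $\langle d_1\rangle$. 2. While $k\ne n$: - $\ell\leftarrow k$; $m\leftarrow d_k$. - While $m=1$: $k\leftarrow k-1$; $m\leftarrow d_k$. - $n'\leftarrow m+\ell-k$; $m\leftarrow m-1$. - While $m<n'$: $d_k\leftarrow m$; $n'\leftarrow n'-m$; $k\leftarrow k+1$. - $d_k\leftarrow n'$; visit $\langle d_1,\dots,d_k\rangle$. *)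

(* Defs.v *)
From mathcomp Require Import all_boot.
Set Implicit Arguments.
Unset Strict Implicit.
Unset Printing Implicit Defensive.

(* A partition of [n] is written as the nonincreasing sequence of its parts. *)
Definition is_partition (n : nat) (s : seq nat) : bool :=
  [&& sorted geq s, 0 \notin s & sumn s == n].

(* A partition of [n] has at most [n] parts, each at most [n], so counting in
   the finite type [n.-bseq 'I_n.+1] misses none: see [partition_bseq]. *)
Definition npart (n : nat) : nat :=
  #|[set s : n.-bseq 'I_n.+1 | is_partition n (map val s)]|.

Lemma partition_bseq (n : nat) (s : seq nat) : is_partition n s ->
  exists2 t : n.-bseq 'I_n.+1, is_partition n (map val t) & map val t = s.
Proof.
move=> Hs; have /and3P[_ s0 /eqP sn] := Hs.
have szs : size s <= n.
  rewrite -{}sn; elim: s s0 {Hs} => //= x s IHs.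
  rewrite inE negb_or => /andP[x0 /IHs les].
  by rewrite -add1n leq_add // lt0n eq_sym.
have les : all (fun x => x < n.+1) s.
  apply/allP => x xs; rewrite ltnS -sn {Hs s0 szs sn}.
  elim: s xs => //= y s IHs; rewrite inE => /predU1P[->|/IHs le_xs].
    exact: leq_addr.
  exact: leq_trans le_xs (leq_addl _ _).
have Hval : map val (map (@inord n) s) = s.
  rewrite -map_comp -[RHS]map_id; apply/eq_in_map => x xs /=.
  by rewrite inordK // (allP les).
have szt : size (map (@inord n) s) <= n by rewrite size_map.
by exists (Bseq szt); rewrite /= Hval.
Qed.

Inductive var := K | L | M | N'.
Scheme Boolean Equality for var.

(* The array is indexed from 1; the cell of index 0 is never used. *)
Record state := State { arr : nat -> nat; reg :> var -> nat }.

Definition set_var (s : state) (x : var) (v : nat) : state :=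
  State (arr s) (fun y => if var_beq x y then v else reg s y).

Definition set_arr (s : state) (i v : nat) : state :=
  State (fun j => if j == i then v else arr s j) (reg s).

Inductive write_site := WInit | WInner | WLast.
Scheme Boolean Equality for write_site.

Inductive cmd :=
| Assign (x : var) (e : state -> nat)
| Write (w : write_site) (i e : state -> nat)
| Visit
| Seq (c1 c2 : cmd)
| While (b : state -> bool) (c : cmd).

Declare Scope cmd_scope.
Delimit Scope cmd_scope with cmd.
Bind Scope cmd_scope with cmd.
Notation "c1 ;; c2" := (Seq c1 c2)
  (at level 90, right associativity, format "'[v' c1  ;; '/' c2 ']'") : cmd_scope.

Inductive event := Written of write_site | Visited of seq nat.

Definition visited (s : state) : seq nat := [seq arr s i | i <- iota 1 (s K)].

(* [exec c s tr s'] : [c], started in [s], terminates in [s'] after producing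
   the sequence of events [tr]. *)
Inductive exec : cmd -> state -> seq event -> state -> Prop :=
| ExecAssign x e s : exec (Assign x e) s [::] (set_var s x (e s))
| ExecWrite w i e s :
    exec (Write w i e) s [:: Written w] (set_arr s (i s) (e s))
| ExecVisit s : exec Visit s [:: Visited (visited s)] s
| ExecSeq c1 c2 s s1 s2 tr1 tr2 :
    exec c1 s tr1 s1 -> exec c2 s1 tr2 s2 ->
    exec (Seq c1 c2) s (tr1 ++ tr2) s2
| ExecWhileF (b : state -> bool) c s : ~~ b s -> exec (While b c) s [::] s
| ExecWhileT (b : state -> bool) c s s1 s2 tr1 tr2 :
    b s -> exec c s tr1 s1 -> exec (While b c) s1 tr2 s2 ->
    exec (While b c) s (tr1 ++ tr2) s2.

(* Subtractions are truncated, but in a run with [n > 0] none of them is ever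
   applied with a larger right operand. *)
Definition RuleDesc (n : nat) : cmd := (
  Write WInit (fun=> 1) (fun=> n) ;;
  Assign K (fun=> 1) ;;
  Visit ;;
  While (fun s => s K != n) (
    Assign L (fun s => s K) ;;
    Assign M (fun s => arr s (s K)) ;;
    While (fun s => s M == 1) (
      Assign K (fun s => s K - 1) ;;
      Assign M (fun s => arr s (s K))
    ) ;;
    Assign N' (fun s => s M + s L - s K) ;;
    Assign M (fun s => s M - 1) ;;
    While (fun s => s M < s N') (
      Write WInner (fun s => s K) (fun s => s M) ;;
      Assign N' (fun s => s N' - s M) ;;
      Assign K (fun s => s K + 1)
    ) ;;
    Write WLast (fun s => s K) (fun s => s N') ;;
    Visit
  ))%cmd.

Definition is_write (w : write_site) (e : event) : bool :=
  if e is Written w' then write_site_beq w w' else false.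

(* Main.v *)
(** The potential of a descending composition [d] of [n] is the number of
    nonempty partitions of integers at most [n] that come after [d] in reverse
    lexicographic order and are not prefixes of [d]: those that agree with [d]
    before some position [i] and carry a smaller part there.  Each write lowers
    the potential by exactly one.  It vanishes on the final composition
    [1, ..., 1], and initially it counts all nonempty partitions of integers at
    most [n] except [n] itself. *)
Require Import Defs.
From mathcomp Require Import all_boot.
From mathcomp Require Import zify.

Set Implicit Arguments.
Unset Strict Implicit.
Unset Printing Implicit Defensive.

(** * Partitions with bounded parts *)

Definition partitions (r : nat) : seq (seq nat) :=
  [seq map val (val t) | t <- enum [set s : r.-bseq 'I_r.+1 | is_partition r (map val s)]].

Lemma size_partitions r : size (partitions r) = npart r.
Proof. by rewrite size_map -cardE. Qed.

Lemma partitions_uniq r : uniq (partitions r).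
Proof.
rewrite map_inj_uniq ?enum_uniq // => s t /(inj_map val_inj).
exact: val_inj.
Qed.

Lemma mem_partitions r s : (s \in partitions r) = is_partition r s.
Proof.
apply/mapP/idP => [[t]|/partition_bseq[t pt <-]].
  by rewrite mem_enum inE => pt ->.
by exists t; rewrite // mem_enum inE.
Qed.

Lemma is_partition_cons r x s :
  is_partition r (x :: s) =
  [&& 0 < x, x <= r, head 0 s <= x & is_partition (r - x) s].
Proof.
rewrite /is_partition /= inE negb_or lt0n eq_sym.
have -> : path geq x s = (head 0 s <= x) && sorted geq s by case: s.
have -> : (x + sumn s == r) = (x <= r) && (sumn s == r - x) by lia.
by case: (x != 0); case: (x <= r); case: (head 0 s <= x); case: sorted;
  case: (0 \notin s).
Qed.

Lemma partitions0 : perm_eq (partitions 0) [:: [::]].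
Proof.
apply: uniq_perm => //; first exact: partitions_uniq.
move=> [|x s]; rewrite mem_partitions !inE // is_partition_cons.
by case: x.
Qed.

(** The default [0] of [head] lets the empty partition pass for every [m]. *)
Definition npart_le (m r : nat) : nat :=
  count (fun s => head 0 s <= m) (partitions r).

Lemma npart_le_full m r : r <= m -> npart_le m r = npart r.
Proof.
move=> le_rm; rewrite -size_partitions; apply/eqP; rewrite -all_count.
apply/allP => -[|x s] //=; rewrite mem_partitions is_partition_cons.
by case/and3P=> _ le_xr _; apply: leq_trans le_xr le_rm.
Qed.

Lemma npart_le_n0 m : npart_le m 0 = 1.
Proof. by rewrite /npart_le (permP partitions0). Qed.

Lemma npart_le_0n r : 0 < r -> npart_le 0 r = 0.
Proof.
move=> r0; apply/eqP; rewrite -leqn0 leqNgt -has_count.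
apply/hasPn => -[|x s]; rewrite mem_partitions; first by case: r r0.
by rewrite is_partition_cons /= -ltnNge => /andP[].
Qed.

(** Removing one largest part [m.+1] is a bijection onto the partitions of [r - m.+1] into parts at
    most [m.+1]. *)
Lemma npart_leS m r :
  npart_le m.+1 r = npart_le m r + (if m < r then npart_le m.+1 (r - m.+1) else 0).
Proof.
have countS (l : seq (seq nat)) : count (fun s => head 0 s <= m.+1) l
    = count (fun s => head 0 s <= m) l + count (fun s => head 0 s == m.+1) l.
  by elim: l => //= s l ->; lia.
rewrite {1}/npart_le countS; congr (_ + _).
case: ltnP => le_mr.
  rewrite /npart_le -!size_filter -[RHS](size_map (cons m.+1)); apply: perm_size.
  apply: uniq_perm; first exact/filter_uniq/partitions_uniq.
    by rewrite map_inj_uniq; [exact/filter_uniq/partitions_uniq | move=> s t []].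
  move=> s; rewrite mem_filter mem_partitions.
  apply/andP/mapP => [|[t + ->]].
    case: s => [[]//|x s [/eqP/= ->]]; rewrite is_partition_cons.
    by case/and4P=> _ _ hs ps; exists s; rewrite // mem_filter hs mem_partitions.
  rewrite mem_filter mem_partitions => /andP[ht pt].
  by rewrite is_partition_cons ltnS le_mr ht pt /=.
apply/eqP; rewrite -leqn0 leqNgt -has_count.
apply/hasPn => -[|x s] //=; rewrite mem_partitions is_partition_cons.
by case/and3P=> _ le_xr _; lia.
Qed.

Definition npart_upto (m r : nat) : nat := \sum_(1 <= x < r.+1) npart_le m x.

Lemma npart_upto0 r : npart_upto 0 r = 0.
Proof. by rewrite /npart_upto big_nat big1 // => x /andP[/npart_le_0n]. Qed.

Lemma npart_upton0 m : npart_upto m 0 = 0.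
Proof. by rewrite /npart_upto big_geq. Qed.

Lemma npart_upto_full m r :
  r <= m -> npart_upto m r = \sum_(1 <= x < r.+1) npart x.
Proof.
move=> le_rm; apply: eq_big_nat => x /andP[_ lt_xr].
by rewrite npart_le_full //; lia.
Qed.

(* The successor accounts for the one-part partition [m]. *)
Lemma npart_uptoE m r : 0 < m <= r ->
  npart_upto m r = npart_upto m.-1 r + (npart_upto m (r - m)).+1.
Proof.
case: m => // m /= lt_mr; rewrite /npart_upto.
under eq_bigr do rewrite npart_leS.
rewrite big_split /=; congr (_ + _).
(* Below [m.+1] the correction vanishes. From there on, shifting the index by [m.+1] makes the first
   term count the empty partition, whence the successor. *)
rewrite (big_cat_nat _ (n := m.+1)) //=; last lia.
rewrite big_nat big1 => [|x]; last by case/andP=> _ lt_xm; rewrite ltnNge -ltnS lt_xm.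
rewrite add0n -{1}[m.+1]add0n big_addn subSn //.
rewrite big_ltn // addnK add0n ltnSn npart_le_n0 add1n; congr _.+1.
by apply: eq_big_nat => x _; rewrite leq_addl addnK.
Qed.

(** This singles out the one-part partition [m], which later pays for the write [WLast]. *)
Lemma npart_upto_diag m : 0 < m -> npart_upto m m = (npart_upto m.-1 m).+1.
Proof.
by move=> m0; rewrite npart_uptoE ?m0 ?leqnn // subnn npart_upton0 addn1.
Qed.

(** * Runs with counted writes *)

Lemma exec_deterministic c s tr1 s1 tr2 s2 :
  exec c s tr1 s1 -> exec c s tr2 s2 -> tr1 = tr2 /\ s1 = s2.
Proof.
move=> e1; elim: e1 tr2 s2 => {c s tr1 s1}.
- by move=> x e s tr2 s2 e2; inversion e2.
- by move=> w i e s tr2 s2 e2; inversion e2.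
- by move=> s tr2 s2 e2; inversion e2.
- move=> c1 c2 s s1 s' tr1 tr1' _ IH1 _ IH2 tr2 s2 e2; inversion e2; subst.
  have [? ?] := IH1 _ _ ltac:(eassumption); subst.
  by have [-> ->] := IH2 _ _ ltac:(eassumption).
- by move=> b c s /negP nb tr2 s2 e2; inversion e2.
- move=> b c s s1 s' tr1 tr1' bs _ IH1 _ IH2 tr2 s2 e2.
  have /negP nbs : ~~ ~~ b s by rewrite negbK.
  inversion e2; subst => //.
  have [? ?] := IH1 _ _ ltac:(eassumption); subst.
  by have [-> ->] := IH2 _ _ ltac:(eassumption).
Qed.

Definition writes (tr : seq event) : nat :=
  count (is_write WInner) tr + count (is_write WLast) tr.

Lemma writes_cat tr1 tr2 : writes (tr1 ++ tr2) = writes tr1 + writes tr2.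
Proof. by rewrite /writes !count_cat addnACA. Qed.

Definition runs (c : cmd) (s : state) (Q : nat -> state -> Prop) : Prop :=
  exists tr s', exec c s tr s' /\ Q (writes tr) s'.

Lemma runs_weaken (Q Q' : nat -> state -> Prop) c s :
  runs c s Q -> (forall w s', Q w s' -> Q' w s') -> runs c s Q'.
Proof. by case=> tr [s' [e q]] QQ'; exists tr, s'; split=> //; apply: QQ'. Qed.

Lemma runs_assign (Q : nat -> state -> Prop) x e s :
  Q 0 (set_var s x (e s)) -> runs (Assign x e) s Q.
Proof. by move=> q; do 2!eexists; split; first exact: ExecAssign. Qed.

Lemma runs_write (Q : nat -> state -> Prop) w i e s :
  Q (writes [:: Written w]) (set_arr s (i s) (e s)) -> runs (Write w i e) s Q.
Proof. by move=> q; do 2!eexists; split; first exact: ExecWrite. Qed.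

Lemma runs_visit (Q : nat -> state -> Prop) s : Q 0 s -> runs Visit s Q.
Proof. by move=> q; do 2!eexists; split; first exact: ExecVisit. Qed.

Lemma runs_seq (Q : nat -> state -> Prop) c1 c2 s :
  runs c1 s (fun w1 s1 => runs c2 s1 (fun w2 s2 => Q (w1 + w2) s2)) ->
  runs (Seq c1 c2) s Q.
Proof.
move=> [tr1 [s1 [e1 [tr2 [s2 [e2 q]]]]]].
by do 2!eexists; split; [exact: ExecSeq e1 e2 | rewrite writes_cat].
Qed.

(** [meas] yields termination, while [pot] telescopes into the number of writes. They are separate
    since a loop without counted writes terminates at constant [pot]. *)
Lemma runs_while (Inv : state -> Prop) (pot meas : state -> nat)
    (b : state -> bool) c :
  (forall s, Inv s -> b s -> runs c s (fun w s' =>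
     [/\ Inv s', pot s = w + pot s' & meas s' < meas s])) ->
  forall s, Inv s -> runs (While b c) s (fun w s' =>
     [/\ Inv s', pot s = w + pot s' & ~~ b s']).
Proof.
move=> body s; have [k] := ubnP (meas s); elim: k s => // k IH s le_k inv.
case: (boolP (b s)) => bs; last first.
  by do 2!eexists; split; first exact: ExecWhileF.
have [tr1 [s1 [e1 [inv1 p1 lt1]]]] := body _ inv bs.
have [|tr2 [s2 [e2 [inv2 p2 nb]]]] := IH s1 _ inv1; first lia.
do 2!eexists; split; first exact: ExecWhileT bs e1 e2.
by split; rewrite // writes_cat -addnA -p2.
Qed.

(** * The potential of an array prefix *)

Definition psum (a : nat -> nat) (k : nat) : nat := \sum_(1 <= i < k) a i.

(** Term [i] counts the nonempty tails that may start at position [i]: parts below [a i], sum at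
    most what the earlier parts leave of [n]. As [k] is exclusive, a composition with [k] parts is
    measured at [k.+1]. *)
Definition potential (n : nat) (a : nat -> nat) (k : nat) : nat :=
  \sum_(1 <= i < k) npart_upto (a i).-1 (n - psum a i).

Lemma psumS a k : 0 < k -> psum a k.+1 = psum a k + a k.
Proof. by move=> k0; rewrite /psum big_nat_recr. Qed.

Lemma potentialS n a k : 0 < k ->
  potential n a k.+1 = potential n a k + npart_upto (a k).-1 (n - psum a k).
Proof. by move=> k0; rewrite /potential big_nat_recr. Qed.

Definition upd (a : nat -> nat) (k v : nat) : nat -> nat :=
  fun j => if j == k then v else a j.

Arguments upd : simpl never.

Lemma psum_upd a k v j : j <= k -> psum (upd a k v) j = psum a j.
Proof.
move=> le_jk; apply: eq_big_nat => i /andP[_ lt_ij].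
by rewrite /upd ltn_eqF //; lia.
Qed.

Lemma potential_upd n a k v : potential n (upd a k v) k = potential n a k.
Proof.
apply: eq_big_nat => i /andP[_ lt_ik].
by rewrite psum_upd ?(ltnW lt_ik) // /upd ltn_eqF.
Qed.

(** Equality in the termwise comparison with 1 forces every entry to be 1, and no positive part is
    smaller. *)
Lemma potential_ones n a : (forall i, 0 < i <= n -> 0 < a i) ->
  psum a n.+1 = n -> potential n a n.+1 = 0.
Proof.
move=> a_gt0 sum_a; rewrite /potential big_nat big1 // => i lt_in.
suff -> : a i = 1 by rewrite npart_upto0.
have le_sum := leqif_sum (I := 'I_n) (P := xpredT) (E1 := fun=> 1)
  (E2 := fun j => a j.+1) (C := fun j => 1 == a j.+1).
have [] := le_sum _.
  by move=> j _; split; rewrite // a_gt0 //= ltn_ord.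
rewrite sum1_card card_ord; have <- : psum a n.+1 = \sum_(j < n) a j.+1.
  by rewrite /psum big_add1 /= big_mkord.
rewrite sum_a eqxx => _ /esym/forall_inP all1.
have lt_i : i.-1 < n by lia.
have := all1 (Ordinal lt_i) isT; rewrite /= prednK; last by lia.
by move/eqP.
Qed.

(** * Invariants and runs of the loops *)

Definition positive (a : nat -> nat) (k : nat) : Prop :=
  forall i, 0 < i < k -> 0 < a i.

Definition outer_inv (n : nat) (s : state) : Prop :=
  [/\ 0 < s K, positive (arr s) (s K).+1 & psum (arr s) (s K).+1 = n].

(** [s L - s K] is the number of trailing ones already skipped, and [p] is the potential at loop
    entry. [s L != n] excludes the all-ones composition. *)
Definition ones_inv (n p : nat) (s : state) : Prop :=
  [/\ 0 < s K <= s L, s M = arr s (s K), positive (arr s) (s K).+1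
    & s L != n] /\
  psum (arr s) (s K).+1 + (s L - s K) = n /\
  potential n (arr s) (s K).+1 = p.

Definition inner_inv (n : nat) (s : state) : Prop :=
  [/\ 0 < s K, 0 < s M, 0 < s N', positive (arr s) (s K)
    & psum (arr s) (s K) + s N' = n].

(** Cell [K] is still to be written: the second summand counts the tails available there, with parts
    at most [M] and sum at most [N']. *)
Definition inner_pot (n : nat) (s : state) : nat :=
  potential n (arr s) (s K) + npart_upto (s M) (s N').

Lemma positive_upd a k v :
  0 < v -> positive a k -> positive (upd a k v) k.+1.
Proof.
move=> v0 pa i lt_ik; rewrite /upd; case: eqVneq => // ne.
by apply: pa; lia.
Qed.

Lemma upd_same a k v : upd a k v k = v.
Proof. by rewrite /upd eqxx. Qed.

Lemma runs_ones n p s : ones_inv n p s ->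
  runs (While (fun s => s M == 1) (
    Assign K (fun s => s K - 1) ;;
    Assign M (fun s => arr s (s K)))%cmd) s
  (fun w s' => [/\ ones_inv n p s', w = 0 & s' M != 1]).
Proof.
move=> inv.
have step s1 : ones_inv n p s1 -> s1 M == 1 ->
    runs (Assign K (fun s => s K - 1) ;; Assign M (fun s => arr s (s K)))%cmd s1
    (fun w s' => [/\ ones_inv n p s', 0 = w + 0 & s' K < s1 K]).
  case=> -[/andP[k0 le_kl] mE pos nl] [sumE potE] /eqP m1.
  have ak1 : arr s1 (s1 K) = 1 by rewrite -mE.
  (* A 1 in the first cell would give [n = 1 + (L - 1) = L]. *)
  have k1 : 1 < s1 K.
    rewrite ltn_neqAle k0 andbT; apply: contra nl => /eqP k1.
    by move: sumE; rewrite psumS // -k1 /psum big_geq // {1}k1 ak1; lia.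
  apply/runs_seq/runs_assign/runs_assign => /=; split=> //; last by lia.
  have kE : (s1 K - 1).+1 = s1 K by lia.
  split=> /=.
    by split=> //; [lia | rewrite kE => i lt_i; apply: pos; lia].
  rewrite kE; split.
    by move: sumE; rewrite psumS // ak1; lia.
  by rewrite -potE potentialS // ak1 npart_upto0 addn0.
apply: (runs_weaken (runs_while (pot := fun=> 0) step inv)) => w s'.
by case=> ? /esym/eqP; rewrite addn0 => /eqP.
Qed.

(** By [npart_uptoE], the available tails split into those with parts below [M], which become the
    term of the written cell, the tail [M] alone, which pays for the write, and the proper
    extensions of [M], which stay available. *)
Lemma runs_inner n s : inner_inv n s ->
  runs (While (fun s => s M < s N') (
      Write WInner (fun s => s K) (fun s => s M) ;;
      Assign N' (fun s => s N' - s M) ;;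
      Assign K (fun s => s K + 1))%cmd) s
  (fun w s' => [/\ inner_inv n s', inner_pot n s = w + inner_pot n s'
     & ~~ (s' M < s' N')]).
Proof.
move: s; apply: (runs_while (meas := fun s => s N')) => s.
case=> k0 m0 n0 pos sumE lt_mn.
apply/runs_seq/runs_write/runs_seq/runs_assign/runs_assign => /=.
rewrite /inner_inv /inner_pot /= addn1 -/(upd _ _ _); split; last by lia.
  split=> //; [by lia | exact: positive_upd |].
  by rewrite psumS // psum_upd // upd_same; lia.
rewrite potentialS // potential_upd psum_upd // upd_same.
rewrite npart_uptoE; last by lia.
have -> : n - psum (arr s) (s K) = s N' by lia.
by rewrite /writes /=; lia.
Qed.

(** The potential is also the termination measure, since each round executes [WLast] once. *)
Lemma runs_outer n s : outer_inv n s ->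
  runs (While (fun s => s K != n) (
    Assign L (fun s => s K) ;;
    Assign M (fun s => arr s (s K)) ;;
    While (fun s => s M == 1) (
      Assign K (fun s => s K - 1) ;;
      Assign M (fun s => arr s (s K))
    ) ;;
    Assign N' (fun s => s M + s L - s K) ;;
    Assign M (fun s => s M - 1) ;;
    While (fun s => s M < s N') (
      Write WInner (fun s => s K) (fun s => s M) ;;
      Assign N' (fun s => s N' - s M) ;;
      Assign K (fun s => s K + 1)
    ) ;;
    Write WLast (fun s => s K) (fun s => s N') ;;
    Visit)%cmd) s
  (fun w s' => potential n (arr s) (s K).+1 = w).
Proof.
set body := (X in While _ X).
pose pot s := potential n (arr s) (s K).+1.
have step s1 : outer_inv n s1 -> s1 K != n ->
    runs body s1 (fun w s' => [/\ outer_inv n s', pot s1 = w + pot s' & pot s' < pot s1]).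
  case=> k0 pos sumE nk.
  apply/runs_seq/runs_assign/runs_seq/runs_assign/runs_seq => /=.
  apply: (@runs_weaken _ _ _ _ (@runs_ones n (pot s1) _ _)).
    by split; split=> //=; rewrite ?k0 ?leqnn // subnn addn0.
  move=> w s2 [[[/andP[k2 le_kl] mE pos2 _] [sum2 pot2]] -> m2].
  have m_gt1 : 1 < s2 M.
    by have := pos2 (s2 K); rewrite -mE; lia.
  apply/runs_seq/runs_assign/runs_seq/runs_assign/runs_seq => /=.
  apply: (@runs_weaken _ _ _ _ (@runs_inner n _ _)).
    split=> //=; [by lia | by lia | by move=> i lt_i; apply: pos2; lia |].
    by move: sum2; rewrite psumS // -mE; lia.
  move=> w' s3 [[k3 m3 n3 pos3 sum3] pot3 le_nm].
  apply/runs_seq/runs_write/runs_visit => /=.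
  rewrite /outer_inv [pot (set_arr _ _ _)]/pot /= -/(upd _ _ _).
  (* On entry to the inner loop [M] is one less than the part at [K], and [N'] is all that the parts
     before [K] leave of [n]. *)
  have potE : pot s1 = w' + inner_pot n s3.
    rewrite -pot3 -pot2 /inner_pot /= potentialS // -mE subn1; congr (_ + npart_upto _ _).
    by move: sum2; rewrite psumS // -mE; lia.
  (* On exit [N' <= M], so the bound [M] can be replaced by [N']; the tail [N'] alone then pays for
     [WLast]. *)
  have innerE : inner_pot n s3 = (potential n (upd (arr s3) (s3 K) (s3 N')) (s3 K).+1).+1.
    rewrite /inner_pot potentialS // potential_upd psum_upd // upd_same.
    rewrite npart_upto_full; last by lia.
    rewrite -(npart_upto_full (leqnn _)) npart_upto_diag // addnS.
    by congr (_ + npart_upto _ _).+1; lia.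
  split; last by rewrite potE innerE; lia.
    split=> //; first exact: positive_upd.
    by rewrite psumS // psum_upd // upd_same.
  by rewrite potE innerE /writes /=; lia.
move=> inv.
apply: (runs_weaken (runs_while step inv)) => w s' [[k0 pos sumE] potE].
rewrite negbK => /eqP kn; move: potE; rewrite /pot => ->.
rewrite kn in pos sumE *.
by rewrite potential_ones // addn0.
Qed.

(* The contents of the variables and of the array before the run, [s0], are
   arbitrary; the first conjunct says that the run terminates. *)
Theorem theorem3p12 (n : nat) (n_gt0 : 0 < n) (s0 : state) :
  (exists tr s, exec (RuleDesc n) s0 tr s) /\
  (forall tr s, exec (RuleDesc n) s0 tr s ->
     count (is_write WInner) tr + count (is_write WLast) tr
     = (\sum_(1 <= x < n.+1) npart x) - 1).
Proof.
(* By determinism, one terminating run with the right count suffices. *)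
suff [tr [s [e wE]]] : runs (RuleDesc n) s0
    (fun w _ => w = (\sum_(1 <= x < n.+1) npart x) - 1).
  split; first by exists tr, s.
  by move=> tr' s' e'; have [-> _] := exec_deterministic e' e.
apply/runs_seq/runs_write/runs_seq/runs_assign/runs_seq/runs_visit => /=.
apply: (@runs_weaken _ _ _ _ (@runs_outer n _ _)) => [|w s' <-].
  split=> //= [i|]; last by rewrite psumS // /psum big_geq.
  by case: i => [|[]].
(* The initial potential is its term at position 1, [npart_upto n.-1 n], which misses only the
   partition [n] itself. *)
rewrite potentialS // [potential _ _ _]big_geq // [psum _ _]big_geq // subn0 /=.
by rewrite -(npart_upto_full (leqnn n)) npart_upto_diag // subn1.
Qed.
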